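(* Let $E$ and $B$ be finite $T_0$-spaces with $E\neq\varnothing$ and let $p\colon E\to B$ be a Hurewicz fibration. Let $e\in E$ and let $b\in U_{p(e)}$. Then $U_e\cap p^{-1}(b)\neq\varnothing$.
   Context: A finite $T_0$-space $X$ is regarded as a poset: $U_a$ denotes the smallest open subset of $X$ containing $a$, and $x\leq y$ if and only if $U_x\subseteq U_y$, so that $U_a=\{x\in X: x\leq a\}$. Continuous maps between finite $T_0$-spaces are exactly the order-preserving maps. A Hurewicz fibration is a continuous map with the homotopy lifting property with respect to all topological spaces. *)

(* Defs.v *)
From HB Require Import structures.
From mathcomp Require Import all_boot all_order all_algebra.
From mathcomp Require Import all_classical all_reals.
From mathcomp Require Import topology.

Set Implicit Arguments.
Unset Strict Implicit.
Unset Printing Implicit Defensive.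

Import Order.TTheory GRing.Theory Num.Theory.
Import numFieldTopology.Exports.

Local Open Scope classical_set_scope.
Local Open Scope ring_scope.

(* The coercion [set_type] carries the topology induced by the inclusion. *)
Definition unit_interval (R : realType) : topologicalType :=
  set_type (`[0, 1]%classic : set R).

Lemma zero_in_unit_interval (R : realType) : (0 : R) \in `[0, 1]%classic.
Proof. by rewrite inE /= in_itv /= lexx ler01. Qed.

Definition I0 (R : realType) : unit_interval R :=
  exist _ 0 (zero_in_unit_interval R).

Definition homotopy_lifting_property (R : realType) (E B : topologicalType)
    (p : E -> B) (X : topologicalType) : Prop :=
  forall (f : X -> E) (H : X * unit_interval R -> B),
    continuous f -> continuous H ->
    (forall x, H (x, I0 R) = p (f x)) ->
    exists K : X * unit_interval R -> E,
      [/\ continuous K, forall x, K (x, I0 R) = f x & p \o K = H].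

Definition hurewicz_fibration (R : realType) (E B : topologicalType)
    (p : E -> B) : Prop :=
  continuous p /\
  forall X : topologicalType, homotopy_lifting_property R p X.

Definition finite_T0_space (X : topologicalType) : Prop :=
  finite_set [set: X] /\ kolmogorov_space X.

(* [smallest open [set a]] is the intersection of all open sets containing a;
   in a finite space it is itself open (see [open_minimal_open]). *)
Definition minimal_open (X : topologicalType) (a : X) : set X :=
  smallest open [set a].

Lemma open_minimal_open (X : topologicalType) (a : X) :
  finite_set [set: X] -> open (minimal_open a).
Proof.
move=> finX; pose N (y : X) := [set M : set X | open M /\ M a /\ ~ M y].
pose g y := xget setT (N y).
have gP y : open (g y) /\ g y a.
  rewrite /g; case: xgetP => [M _ [oM [Ma _]]|_] //; split => //; exact: openT.
suff -> : minimal_open a = \bigcap_(y in [set: X]) g y.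
  rewrite -[X in open X]setCK; apply: closed_openC; rewrite setC_bigcap.
  by apply: closed_bigcup => // y _; exact/open_closedC/(gP y).1.
apply/seteqP; split=> x /= hx.
  move=> y _; apply: hx; split; [exact: (gP y).1|].
  by move=> _ /= ->; exact: (gP y).2.
move=> M [oM aM]; apply: contrapT => nMx; have := hx x I.
rewrite /g; case: xgetP => [M' _ [_ [_ nM'x]] //|/(_ M)] nN.
by case: nN; split => //; split => //; exact: aM.
Qed.

(* Main.v *)
(* Sending 0 to p(e) and every t > 0 to b is a path in B because b <= p(e). A
   lift of it starting at e stays in the open set U_e for small t, and lies over
   b as soon as t > 0. *)

Require Import Defs.
From mathcomp Require Import all_boot all_order all_algebra.
From mathcomp Require Import all_classical all_reals.
From mathcomp Require Import topology.
From mathcomp Require Import normedtype.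

Import Order.TTheory GRing.Theory Num.Theory.
Import numFieldTopology.Exports.

Local Open Scope classical_set_scope.

(** The relation [b] in the minimal open set of [p e] is turned into a path from [p e] that reaches
    [b] immediately ([continuous_jump_path]). Its lift from [e] cannot leave the open set
    [minimal_open e] at once, and 0 is not isolated in the interval ([nbhs_I0_neq0]), so some
    positive time gives a point of [minimal_open e] over [b]. *)

Definition jump_path (R : realType) {B : Type} (a b : B)
    (t : unit_interval R) : B :=
  if set_val t == 0%R then a else b.

(** An open set containing [a] also contains [b], so the preimage of an open set is everything,
    empty, or the set of nonzero times; the closed set {0} alone never occurs. *)
Lemma continuous_jump_path (R : realType) (B : topologicalType) (a b : B) :
  minimal_open a b -> continuous (jump_path R a b).
Proof.
move=> ab; apply/continuousP => A oA.
have [Aa|nAa] := pselect (A a).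
  have Ab : A b by apply: ab; split => // _ ->.
  suff -> : jump_path R a b @^-1` A = setT by exact: openT.
  by apply/seteqP; split=> // t _; rewrite /preimage/= /jump_path; case: ifP.
have [Ab|nAb] := pselect (A b); last first.
  suff -> : jump_path R a b @^-1` A = set0 by exact: open0.
  by apply/seteqP; split=> // t; rewrite /preimage/= /jump_path; case: ifP.
exists [set x : R | x != 0%R]; first exact: open_neq.
apply/seteqP; split=> t; rewrite /preimage/= /jump_path.
  by move=> /negPf ->.
by case: ifP.
Qed.

Lemma nbhs_I0_neq0 (R : realType) (A : set (unit_interval R)) :
  nbhs (I0 R) A -> exists2 t, A t & set_val t != 0%R.
Proof.
move=> [_ /= [[O oO <-] O0 OA]].
have [x [[Ox x0] x1]] : exists x : R, (O x /\ (0 < x)%R) /\ (x < 1)%R.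
  (* The filter of right neighbourhoods of 0 is proper and contains all three conditions. *)
  apply: (@filter_ex _ (at_right (0 : R)%R)).
  apply: filterI; last exact: nbhs_right_lt.
  apply: filterI; last exact: nbhs_right_gt.
  have nO : nbhs (0 : R)%R O by apply: open_nbhs_nbhs.
  by rewrite /at_right /within/=; apply: filterS nO.
have xI : x \in (`[0%R, 1%R]%classic : set R).
  by rewrite inE /= in_itv /= !ltW.
exists (exist _ x xI); first exact: OA.
exact: lt0r_neq0.
Qed.

Lemma pair_continuous (X Y : topologicalType) (x : X) :
  continuous (pair x : Y -> X * Y).
Proof.
by move=> y; apply: (@cvg_pair _ _ _ _ (nbhs x) (nbhs y));
  [exact: cvg_cst|exact: cvg_id].
Qed.

Theorem theorem5p6 (R : realType) (E B : topologicalType)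
    (hE : finite_T0_space E) (hB : finite_T0_space B)
    (hE0 : [set: E] !=set0)
    (p : E -> B) (hp : hurewicz_fibration R p)
    (e : E) (b : B) (hb : minimal_open (p e) b) :
  minimal_open e `&` p @^-1` [set b] !=set0.
Proof.
have [_ lift] := hp.
(* A path is lifted as a homotopy with parameter space [E] that ignores the parameter, starting from
   the constant map [e]; the lift is then restricted to the slice over [e]. *)
have cH : continuous (fun z : E * unit_interval R => jump_path R (p e) b z.2).
  move=> z; apply: continuous_comp; first exact: cvg_snd.
  exact: continuous_jump_path.
have [||K [cK K0 pK]] := lift E (fun=> e) _ _ cH.
- by move=> x; exact: cvg_cst.
- by move=> x; rewrite /jump_path/= eqxx.
have cKt : {for I0 R, continuous (fun t => K (e, t))}.
  by apply: (@continuous_comp _ _ _ (pair e) K);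
    [exact: pair_continuous|exact: cK].
have [|t Ut t0] := nbhs_I0_neq0 R ((fun t => K (e, t)) @^-1` minimal_open e).
  (* Finiteness of [E] makes [minimal_open e] a neighbourhood of [e], the value of the lift at time
     0. *)
  apply: cKt; rewrite K0; apply: open_nbhs_nbhs; split.
    by apply: open_minimal_open; case: hE.
  by move=> M [_ Me]; exact: Me.
exists (K (e, t)); split => //.
by have /= -> := congr1 (@^~ (e, t)) pK; rewrite /jump_path (negPf t0).
Qed.
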